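(* For all $f,g,h\in\mathcal{A}$, $$\mathrm{area}(\mathrm{area}(f,g),h)+\mathrm{area}(\mathrm{area}(g,h),f)+\mathrm{area}(\mathrm{area}(h,f),g) = -f ⧢ \mathrm{area}(g,h) - g ⧢ \mathrm{area}(h,f) - h ⧢ \mathrm{area}(f,g).$$
   Context: Let $A$ be a finite alphabet, $W_A$ the set of all words over $A$ including the empty word $e$, and $\mathcal{A}$ the real vector space with basis $W_A$. For $f\in\mathcal{A}$, $\langle f,e\rangle$ denotes the coefficient of $e$ in $f$. Juxtaposition denotes concatenation of words, extended bilinearly. The (left) half shuffle $\prec:\mathcal{A}\times\mathcal{A}\to\mathcal{A}$ is the bilinear map determined on words by: $e\prec w=0$ for every word $w$ (including $w=e$); $u\prec e=u$ for every non-empty word $u$; $a\prec w=aw$ for every letter $a$ and word $w$; and recursively $(au)\prec w=a(u\prec w+w\prec u)$ for every letter $a$, non-empty word $u$ and word $w$. The shuffle product is $f ⧢ g = f\prec g+g\prec f+\langle f,e\rangle\langle g,e\rangle e$; it is associative and commutative. The operator $\mathrm{area}:\mathcal{A}\times\mathcal{A}\to\mathcal{A}$ is $\mathrm{area}(f,g)=f\prec g-g\prec f$. *)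

(* Defs.v *)
From HB Require Import structures.
From mathcomp Require Import all_boot all_order all_algebra finmap.
From mathcomp Require Import reals monalg.

Set Implicit Arguments.
Unset Strict Implicit.
Unset Printing Implicit Defensive.

Import GRing.Theory.
Local Open Scope ring_scope.

(* Words over [A] are the elements of the free monoid [{fmonom A}] (a wrapper
   around [seq A] with concatenation as product and [mone] as empty word), and
   the real vector space with basis the words is the associated monoid algebra:
   its product is the bilinear extension of concatenation, its unit [1] is the
   basis vector of the empty word, and [f@_mone] is the coefficient of the empty
   word in [f]. *)
Notation wordAlg R A := {malg R[{fmonom A}]}.

Section HalfShuffle.
Variables (R : realType) (A : finType).

Definition wvec (w : seq A) : wordAlg R A := << FMonom w >>.

(* [n] is fuel: every recursive call decreases the total length of the two
   words by one, so [size u + size w] is always enough. *)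
Fixpoint half_words_rec (n : nat) (u w : seq A) : wordAlg R A :=
  if n isn't n'.+1 then 0 else
  match u, w with
  | [::], _ => 0
  | _, [::] => wvec u
  | [:: a], _ => wvec (a :: w)
  | a :: u', _ =>
      wvec [:: a] * (half_words_rec n' u' w + half_words_rec n' w u')
  end.

Definition half_words (u w : seq A) : wordAlg R A :=
  half_words_rec (size u + size w) u w.

Definition half (f g : wordAlg R A) : wordAlg R A :=
  \sum_(u <- msupp f) \sum_(w <- msupp g) (f@_u * g@_w) *: half_words u w.

Definition shuffle (f g : wordAlg R A) : wordAlg R A :=
  half f g + half g f + (f@_mone * g@_mone) *: 1.

Definition area (f g : wordAlg R A) : wordAlg R A := half f g - half g f.

Lemma half_wide (d1 d2 : {fset {fmonom A}}) (f g : wordAlg R A) :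
  (msupp f `<=` d1)%fset -> (msupp g `<=` d2)%fset ->
  half f g = \sum_(u <- d1) \sum_(w <- d2) (f@_u * g@_w) *: half_words u w.
Proof.
move=> le1 le2; rewrite /half (big_fset_incl _ le1) /=; last first.
  move=> u _ /mcoeff_outdom fu; rewrite big1 // => w _.
  by rewrite fu mul0r scale0r.
apply: eq_bigr => u _; apply: big_fset_incl => // w _ /mcoeff_outdom ->.
by rewrite mulr0 scale0r.
Qed.

Lemma half_linearl (g : wordAlg R A) : linear (half^~ g).
Proof.
move=> c f1 f2 /=.
pose d := (msupp (c *: f1 + f2) `|` (msupp f1 `|` msupp f2))%fset.
have sub (f : wordAlg R A) : (msupp f `<=` d)%fset ->
    half f g = \sum_(u <- d) \sum_(w <- msupp g)
                 (f@_u * g@_w) *: half_words u w.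
  by move=> le; apply: half_wide.
rewrite !sub; last first.
- exact: fsubsetUl.
- by rewrite /d fsetUCA fsubsetUl.
- by rewrite /d fsetUA fsubsetUr.
rewrite scaler_sumr -big_split /=; apply: eq_bigr => u _.
rewrite scaler_sumr -big_split /=; apply: eq_bigr => w _.
by rewrite mcoeffD mcoeffZ mulrDl scalerDl scalerA mulrA.
Qed.

Lemma half_linearr (f : wordAlg R A) : linear (half f).
Proof.
move=> c g1 g2 /=.
pose d := (msupp (c *: g1 + g2) `|` (msupp g1 `|` msupp g2))%fset.
have sub (g : wordAlg R A) : (msupp g `<=` d)%fset ->
    half f g = \sum_(u <- msupp f) \sum_(w <- d)
                 (f@_u * g@_w) *: half_words u w.
  by move=> le; apply: half_wide.
rewrite !sub; last first.
- exact: fsubsetUl.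
- by rewrite /d fsetUCA fsubsetUl.
- by rewrite /d fsetUA fsubsetUr.
rewrite scaler_sumr -big_split /=; apply: eq_bigr => u _.
rewrite scaler_sumr -big_split /=; apply: eq_bigr => w _.
by rewrite mcoeffD mcoeffZ mulrDr scalerDl scalerA mulrCA.
Qed.

Lemma half_wvec (u w : seq A) : half (wvec u) (wvec w) = half_words u w.
Proof.
rewrite (half_wide msuppU_le msuppU_le) !big_seq_fset1 !mcoeffUU.
by rewrite mulr1 scale1r.
Qed.

Lemma wvec_cat (u w : seq A) : wvec u * wvec w = wvec (u ++ w).
Proof.
rewrite /wvec -[LHS]/(fgmul _ _) fgmulUU mulr1; congr << _ >>.
by apply/eqP; rewrite fmP fmM.
Qed.

Lemma wvec_nil : wvec [::] = 1.
Proof. by rewrite /wvec; congr << _ >>; apply/eqP; rewrite fmP fm1. Qed.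

Lemma half_words_rec_cons (n : nat) (a b c : A) (u w : seq A) :
  half_words_rec n.+1 (a :: b :: u) (c :: w) =
  wvec [:: a] * (half_words_rec n (b :: u) (c :: w) +
                 half_words_rec n (c :: w) (b :: u)).
Proof. by []. Qed.

Lemma half_nil (w : seq A) : half 1 (wvec w) = 0.
Proof. by rewrite -wvec_nil half_wvec /half_words /=; case: w. Qed.

Lemma half_unit (u : seq A) : u != [::] -> half (wvec u) 1 = wvec u.
Proof.
by rewrite -wvec_nil half_wvec /half_words; case: u => [|a [|b u]].
Qed.

Lemma half_letter (a : A) (w : seq A) :
  half (wvec [:: a]) (wvec w) = wvec [:: a] * wvec w.
Proof. by rewrite wvec_cat half_wvec /half_words; case: w. Qed.

Lemma half_cons (a : A) (u w : seq A) : u != [::] ->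
  half (wvec (a :: u)) (wvec w) =
  wvec [:: a] * (half (wvec u) (wvec w) + half (wvec w) (wvec u)).
Proof.
case: u => [//|b u] _; case: w => [|c w].
  rewrite wvec_nil (half_unit (u := a :: b :: u) isT).
  by rewrite (half_unit (u := b :: u) isT) half_nil addr0 wvec_cat.
rewrite (half_wvec (a :: b :: u)) (half_wvec (b :: u)) (half_wvec (c :: w)).
have comm : half_words (c :: w) (b :: u) =
    half_words_rec (size (b :: u) + size (c :: w)) (c :: w) (b :: u).
  by rewrite addnC.
by rewrite comm; apply: half_words_rec_cons.
Qed.

End HalfShuffle.

(* Main.v *)
(** The half shuffle is a Zinbiel product, [(f ≺ g) ≺ h = f ≺ (g ⧢ h)], and this
    holds on all of the algebra because the counit term of the shuffle product
    accounts for the empty word. The first letter of [f] factors out of both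
    sides, which reduces the identity to associativity of the shuffle on words
    of smaller total length; conversely, the Zinbiel identity shows that
    [(f ⧢ g) ⧢ h] is a symmetric expression in [f], [g], [h], hence
    associativity. In the theorem the terms [f ≺ (g ⧢ h)] cancel cyclically on
    the left, and likewise the terms [area(f, g) ≺ h] on the right; what remains
    on both sides is minus the cyclic sum of [h ≺ area(f, g)]. *)

Require Import Defs.
From mathcomp Require Import all_boot all_order all_algebra finmap.
From mathcomp Require Import reals monalg.
From mathcomp Require Import zify.

Import GRing.Theory.
Local Open Scope ring_scope.

(* Stated for an abstract [prec]: on the monoid algebra itself, rewriting keeps
   unfolding the sums over supports in failing conversion checks. *)
Section AugmentedHalfShuffle.
Variables (K : comPzRingType) (V : lmodType K).
Variables (prec : V -> V -> V) (eps : V -> K) (one : V).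
Hypothesis prec_linearl : forall g, linear (prec^~ g).
Hypothesis prec_linearr : forall f, linear (prec f).
Hypothesis prec1l : forall g, prec one g = 0.
Hypothesis eps_linear : scalar eps.
Hypothesis eps1 : eps one = 1.
Hypothesis eps_prec : forall f g, eps (prec f g) = 0.
Implicit Types f g h : V.

Definition augmented_shuffle f g : V :=
  prec f g + prec g f + (eps f * eps g) *: one.

Definition augmented_area f g : V := prec f g - prec g f.

Local Notation shuffle := augmented_shuffle.
Local Notation area := augmented_area.

Lemma precPl c f1 f2 g : prec (c *: f1 + f2) g = c *: prec f1 g + prec f2 g.
Proof. exact: prec_linearl. Qed.

Lemma precPr c f g1 g2 : prec f (c *: g1 + g2) = c *: prec f g1 + prec f g2.
Proof. exact: prec_linearr. Qed.

Lemma precDl f1 f2 g : prec (f1 + f2) g = prec f1 g + prec f2 g.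
Proof. by have := precPl 1 f1 f2 g; rewrite !scale1r. Qed.

Lemma precBl f1 f2 g : prec (f1 - f2) g = prec f1 g - prec f2 g.
Proof. by rewrite addrC -scaleN1r precPl scaleN1r addrC. Qed.

Lemma eps_shuffle f g : eps (shuffle f g) = eps f * eps g.
Proof.
have epsD f' g' : eps (f' + g') = eps f' + eps g'.
  by have := eps_linear 1 f' g'; rewrite scale1r mul1r.
by rewrite /shuffle addrC eps_linear epsD !eps_prec eps1 mulr1 !addr0.
Qed.

Lemma eps_area f g : eps (area f g) = 0.
Proof. by rewrite /area addrC -scaleN1r eps_linear !eps_prec mulr0 addr0. Qed.

Lemma augmented_shuffleC f g : shuffle f g = shuffle g f.
Proof. by rewrite /shuffle (addrC (prec f g)) (mulrC (eps f)). Qed.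

Lemma augmented_shufflePl c f1 f2 g :
  shuffle (c *: f1 + f2) g = c *: shuffle f1 g + shuffle f2 g.
Proof.
rewrite /shuffle precPl precPr eps_linear mulrDl scalerDl -mulrA -scalerA.
rewrite !scalerDr (addrACA (c *: prec f1 g)).
by rewrite (addrACA (_ + c *: prec g f1)).
Qed.

Lemma augmented_shufflePr c f g1 g2 :
  shuffle f (c *: g1 + g2) = c *: shuffle f g1 + shuffle f g2.
Proof.
by rewrite augmented_shuffleC augmented_shufflePl !(augmented_shuffleC f).
Qed.

Lemma prec_shufflel f g h :
  prec (shuffle f g) h = prec (prec f g) h + prec (prec g f) h.
Proof. by rewrite /shuffle addrC precPl prec1l scaler0 add0r precDl. Qed.

(** The Zinbiel identity is assumed only at the triples needed, so that the lemma is available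
    inside the induction that proves this identity for words. *)
Lemma shuffle_shufflel f g h :
  prec (prec f g) h = prec f (shuffle g h) ->
  prec (prec g f) h = prec g (shuffle f h) ->
  shuffle (shuffle f g) h =
  prec f (shuffle g h) + prec g (shuffle h f) + prec h (shuffle f g)
  + (eps f * eps g * eps h) *: one.
Proof.
move=> zfg zgf; rewrite (augmented_shuffleC h f) -zfg -zgf -prec_shufflel.
by rewrite -eps_shuffle.
Qed.

(** All four instances are at permutations of one triple, hence of the same total length when the
    arguments are words. *)
Lemma augmented_shuffleA f g h :
  prec (prec f g) h = prec f (shuffle g h) ->
  prec (prec g f) h = prec g (shuffle f h) ->
  prec (prec g h) f = prec g (shuffle h f) ->
  prec (prec h g) f = prec h (shuffle g f) ->
  shuffle (shuffle f g) h = shuffle f (shuffle g h).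
Proof.
move=> zfgh zgfh zghf zhgf; rewrite (augmented_shuffleC f (shuffle _ _)).
rewrite !shuffle_shufflel // [eps g * _ * _]mulrC mulrA.
by rewrite [prec f _ + _]addrC [_ + prec f _]addrAC.
Qed.

Hypothesis zinbiel : forall f g h, prec (prec f g) h = prec f (shuffle g h).

(** The six terms given by the Zinbiel identity cancel in pairs, since the shuffle is
    commutative. *)
Lemma prec_area_cyclic f g h :
  prec (area f g) h + prec (area g h) f + prec (area h f) g = 0.
Proof.
rewrite !precBl !zinbiel (augmented_shuffleC h f) (augmented_shuffleC h g).
by rewrite (augmented_shuffleC g f) !addrA !subrK subrr.
Qed.

Lemma shuffle_area f g h :
  shuffle f (area g h) = prec f (area g h) + prec (area g h) f.
Proof. by rewrite /shuffle eps_area mulr0 scale0r addr0. Qed.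

Lemma area_area_cyclic f g h :
  area (area f g) h + area (area g h) f + area (area h f) g =
  - shuffle f (area g h) - shuffle g (area h f) - shuffle h (area f g).
Proof.
rewrite !shuffle_area ![area (area _ _) _]/(prec _ _ - prec _ _).
have := prec_area_cyclic f g h.
move: (prec (area f g) h) (prec (area g h) f) (prec (area h f) g) => x y z.
move: (prec f _) (prec g _) (prec h _) => p q r cyc.
rewrite -!opprD (addrACA x) (addrACA (x + y)) cyc add0r -!opprD.
rewrite (addrACA p) (addrACA (p + q)) [y + z + x]addrC [x + (_ + _)]addrA cyc.
by rewrite addr0 [p + q + r]addrC addrA.
Qed.

End AugmentedHalfShuffle.

Lemma malgU_scale (K : choiceType) (S : nzRingType) (c : S) (k : K) :
  << c *g k >> = c *: << k >> :> {malg S[K]}.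
Proof. by apply/malgP => k'; rewrite mcoeffZ !mcoeffU mulr_natr. Qed.

Lemma malg_scalerAr (K : monomType) (S : comNzRingType) (c : S)
    (g1 g2 : {malg S[K]}) : c *: (g1 * g2) = g1 * (c *: g2).
Proof.
apply/malgP => k; rewrite mcoeffZ (mcoeffMl g1).
(* The support of [c *: g2] may be smaller than that of [g2]; both products are summed over the
   latter. *)
rewrite (@mcoeffMlw _ _ (msupp g1) (msupp g2) _ (c *: g2)) ?msuppZ_le //.
rewrite mulr_sumr; apply: eq_bigr => k1 _; rewrite mulr_sumr.
by apply: eq_bigr => k2 _; rewrite mcoeffZ mulrnAr mulrCA.
Qed.

Lemma malg_mulrP (K : monomType) (S : comNzRingType) (c : S)
    (g1 g2 g3 : {malg S[K]}) : g1 * (c *: g2 + g3) = c *: (g1 * g2) + g1 * g3.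
Proof. by rewrite mulrDr -malg_scalerAr. Qed.

Section WordAlgebra.
Variables (R : realType) (A : finType).
Implicit Types (f g h : wordAlg R A) (u v w : seq A) (a : A).

Local Notation vec := (@wvec R A).
Local Notation half := (@Defs.half R A).

Lemma wordAlg_ind (P : wordAlg R A -> Prop) :
  (forall c f g, P f -> P g -> P (c *: f + g)) ->
  (forall w, P (vec w)) -> forall f, P f.
Proof.
move=> Plin Pvec f.
have P0 : P 0.
  (* Zero is -1 times a word plus the same word. *)
  by rewrite -(addNr (vec [::])) -scaleN1r; apply: Plin.
rewrite [f]monalgE; elim/big_rec: _ => // -[w] g _ Pg.
rewrite malgU_scale; apply: Plin Pg; apply: Pvec.
Qed.

(** Linearity is taken as plain equations, so that the lemma applies to each argument of [half] and
    [shuffle] in turn. *)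
Lemma wordAlg_eq (V : lmodType R) (F G : wordAlg R A -> V) :
  (forall c f g, F (c *: f + g) = c *: F f + F g) ->
  (forall c f g, G (c *: f + g) = c *: G f + G g) ->
  (forall w, F (vec w) = G (vec w)) -> forall f, F f = G f.
Proof.
by move=> FP GP FG; elim/wordAlg_ind=> // c f g Ff Fg; rewrite FP GP Ff Fg.
Qed.

Lemma wordAlg_mulrP c f g h : f * (c *: g + h) = c *: (f * g) + f * h.
Proof. exact: malg_mulrP. Qed.

Let eps f : R := f@_mone.
Let halfl := @half_linearl R A.
Let halfr := @half_linearr R A.

Lemma halfPl c f1 f2 g : half (c *: f1 + f2) g = c *: half f1 g + half f2 g.
Proof. exact: halfl. Qed.

Lemma halfPr c f g1 g2 : half f (c *: g1 + g2) = c *: half f g1 + half f g2.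
Proof. exact: halfr. Qed.

Lemma half0l g : half 0 g = 0.
Proof.
by have := halfPl (-1) 0 0 g; rewrite scaler0 addr0 scaleN1r addNr.
Qed.

Lemma counit_linear : scalar eps.
Proof. by move=> c f g; rewrite /eps mcoeffD mcoeffZ. Qed.

Lemma shufflePl c f1 f2 g :
  shuffle (c *: f1 + f2) g = c *: shuffle f1 g + shuffle f2 g.
Proof. exact: (augmented_shufflePl _ _ half eps 1 halfl halfr counit_linear). Qed.

Lemma shufflePr c f g1 g2 :
  shuffle f (c *: g1 + g2) = c *: shuffle f g1 + shuffle f g2.
Proof. exact: (augmented_shufflePr _ _ half eps 1 halfl halfr counit_linear). Qed.

Lemma half1l g : half 1 g = 0.
Proof.
apply: (@wordAlg_eq _ (half 1) (fun=> 0)) => [c f g'|c _ _|w].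
- exact: halfPr.
- by rewrite scaler0 addr0.
- exact: half_nil.
Qed.

Lemma counit_word w : (vec w)@_mone = (w == [::])%:R.
Proof. by rewrite mcoeffU fmP fm1. Qed.

Lemma counit_letterM a f : (vec [:: a] * f)@_mone = 0.
Proof. by rewrite rmorphM /= counit_word mul0r. Qed.

Lemma shuffle1l f : shuffle 1 f = f.
Proof.
apply: (@wordAlg_eq _ (shuffle 1) id) => // [c f' g|w]; first exact: shufflePr.
rewrite /shuffle half1l add0r -(wvec_nil R A) !counit_word mul1r wvec_nil.
(* For the empty word only the counit term survives, for any other word only [half (vec w) 1]. *)
case: w => [|a w]; first by rewrite wvec_nil half1l add0r scale1r.
by rewrite half_unit // scale0r addr0.
Qed.

(** This merges the two clauses for a word with a first letter: as [1] is neutral for the shuffle,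
    the single-letter clause is the case where [f] is [1]. *)
Lemma half_letterM a f g : half (vec [:: a] * f) g = vec [:: a] * shuffle f g.
Proof.
apply: (@wordAlg_eq _ (fun f => half (vec [:: a] * f) g)
  (fun f => vec [:: a] * shuffle f g)) f => [c f1 f2|c f1 f2|u].
- by rewrite wordAlg_mulrP halfPl.
- by rewrite shufflePl wordAlg_mulrP.
apply: (@wordAlg_eq _ (half (vec [:: a] * vec u))
  (fun g => vec [:: a] * shuffle (vec u) g)) g => [c g1 g2|c g1 g2|w].
- exact: halfPr.
- by rewrite shufflePr wordAlg_mulrP.
case: u => [|b u]; first by rewrite wvec_nil mulr1 half_letter shuffle1l.
rewrite wvec_cat (half_cons R a w (isT : b :: u != [::])) /shuffle.
by rewrite counit_word mul0r scale0r addr0.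
Qed.

(** A nonempty left word passes its first letter on to every word of the result, and the empty one
    gives 0. *)
Lemma counit_half f g : (half f g)@_mone = 0.
Proof.
elim/wordAlg_ind: f => [c f1 f2 I1 I2|[|a u]].
- by rewrite halfPl mcoeffD mcoeffZ [X in _ * X]I1 [X in _ + X]I2 mulr0 addr0.
- by rewrite wvec_nil half1l mcoeff0.
- by rewrite -cat1s -wvec_cat half_letterM counit_letterM.
Qed.

Lemma counit1 : (1 : wordAlg R A)@_mone = 1.
Proof. exact: rmorph1. Qed.

Lemma zinbiel_word u v w :
  half (half (vec u) (vec v)) (vec w) = half (vec u) (shuffle (vec v) (vec w)).
Proof.
have [n] := ubnP (size u + size v + size w).
elim: n u v w => [|n IHn] u v w; first (rewrite ltn0 => /notF[]).
case: u => [|a u] /= lt_n; first by rewrite wvec_nil !half1l half0l.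
rewrite -cat1s -wvec_cat 3!half_letterM; apply: (f_equal (GRing.mul _)).
(* What remains is associativity at [u], [v], [w], with [u] now short of its first letter, so the
   four Zinbiel instances have total length one less. *)
apply: (augmented_shuffleA _ _ half eps 1 halfl half1l counit_linear counit1
  counit_half); apply: IHn; lia.
Qed.

Lemma zinbiel f g h : half (half f g) h = half f (shuffle g h).
Proof.
apply: (@wordAlg_eq _ (fun f => half (half f g) h)
  (fun f => half f (shuffle g h))) f => [c f1 f2|c f1 f2|u].
- by rewrite !halfPl.
- exact: halfPl.
apply: (@wordAlg_eq _ (fun g => half (half (vec u) g) h)
  (fun g => half (vec u) (shuffle g h))) g => [c g1 g2|c g1 g2|v].
- by rewrite halfPr halfPl.
- by rewrite shufflePl halfPr.
apply: (@wordAlg_eq _ (half (half (vec u) (vec v)))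
  (fun h => half (vec u) (shuffle (vec v) h))) h => [c h1 h2|c h1 h2|w].
- exact: halfPr.
- by rewrite shufflePr halfPr.
exact: zinbiel_word.
Qed.

End WordAlgebra.

Theorem lemma3p13 (R : realType) (A : finType) (f g h : wordAlg R A) :
  area (area f g) h + area (area g h) f + area (area h f) g =
  - shuffle f (area g h) - shuffle g (area h f) - shuffle h (area f g).
Proof.
exact: (area_area_cyclic _ _ _ _ 1 (@half_linearl R A)
  (@counit_linear R A) (@counit_half R A) (@zinbiel R A)).
Qed.
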